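(* Let $n\ge1$ and $$\mathcal{A}(q,t):=\sum_{\sigma\in\mathfrak{S}_n(312)}q^{\mathrm{maj}(\sigma)}t^{\mathrm{maj}(\sigma^{-1})}.$$ Then $$\mathcal{A}(q,q)=\frac{1}{[n+1]}\genfrac{[}{]}{0pt}{}{2n}{n}.$$
   Context: $\mathfrak{S}_n(312)$ is the set of permutations $\sigma=\sigma_1\cdots\sigma_n$ of $\{1,\ldots,n\}$ avoiding the pattern $312$ (there are no $i<j<k$ with $\sigma_j<\sigma_k<\sigma_i$). $\mathrm{maj}(\sigma)$ is the sum of all $1\le j\le n-1$ with $\sigma_j>\sigma_{j+1}$. Here $[m]:=\sum_{i=0}^{m-1}q^i$ and $\genfrac{[}{]}{0pt}{}{m}{k}:=\frac{(q)_m}{(q)_k(q)_{m-k}}$ with $(q)_m:=(1-q)(1-q^2)\cdots(1-q^m)$. *)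

(* Defs.v *)
From mathcomp Require Import all_boot all_order all_algebra all_fingroup.
Set Implicit Arguments.
Unset Strict Implicit.
Unset Printing Implicit Defensive.
Import GRing.Theory.
Local Open Scope ring_scope.

(* Positions and values live in 'I_n = {0, ..., n-1} instead of {1, ..., n};
   the shift of values is irrelevant to comparisons. *)
Definition avoids312 (n : nat) (s : 'S_n) : bool :=
  ~~ [exists i : 'I_n, exists j : 'I_n, exists k : 'I_n,
        [&& (i < j)%N, (j < k)%N, (s j < s k)%N & (s k < s i)%N]].

(* A descent at the 0-based position i is a descent at the 1-based position
   i.+1, and contributes i.+1. *)
Definition maj (n : nat) (s : 'S_n) : nat :=
  (\sum_(i < n) \sum_(j < n | (j == i.+1 :> nat) && (s j < s i)) i.+1)%N.

(* Z[q, t] is represented as Z[q][t]: q is the inner variable 'X%:P and t is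
   the outer variable 'X, so that evaluating at 'X : {poly int} is t := q. *)
Definition calA (n : nat) : {poly {poly int}} :=
  \sum_(s : 'S_n | avoids312 s) ('X%:P) ^+ maj s * 'X ^+ maj (s^-1)%g.

Definition qint (F : fieldType) (q : F) (m : nat) : F :=
  \sum_(i < m) q ^+ i.

Definition qpoch (F : fieldType) (q : F) (m : nat) : F :=
  \prod_(i < m) (1 - q ^+ i.+1).

Definition qbinom (F : fieldType) (q : F) (m k : nat) : F :=
  qpoch q m / (qpoch q k * qpoch q (m - k)).

Definition qvar : {fraction {poly int}} := tofrac ('X : {poly int}).

(* Main.v *)
Require Import Defs.
From mathcomp Require Import all_boot all_order all_algebra all_fingroup.
From mathcomp Require Import ring zify.
Set Implicit Arguments.
Unset Strict Implicit.
Unset Printing Implicit Defensive.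
Import GRing.Theory.
Local Open Scope ring_scope.

(** The 312-avoiders are generated by inserting the largest value.  Let s be a
    312-avoider of size N >= 1 whose largest value sits at the 0-based position
    m.  No 312 starts at m, so s decreases from m on ([avoids312_decr]).  Hence
    inserting a new largest value at position i gives a 312-avoider exactly when
    m <= i <= N ([avoids312_insmax]), and every 312-avoider of size N + 1 arises
    once in this way, its largest value being at i.  The insertion changes
    maj(s) + maj(s^-1) by an amount that depends on N, m and i only
    ([weight_insmax]):
    - for i = m, the major index grows by N because all the later descents move
      by one and a new one appears, and the inverse major index grows by N
      because N + 1 now precedes N: together 2N;
    - for i > m, the same gain of N is reduced by the loss of the descent of
      weight i (for i = N there is neither gain nor loss), which leaves
      N - i, and the inverse major index does not move.

    So the sum T_N(i) of q^(maj(s) + maj(s^-1)) over the avoiders with largest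
    value at i and the partial sum P_N(j) = T_N(0) + ... + T_N(j-1) satisfy the
    linear recursion T_(N+1)(i) = q^(2N) T_N(i) + q^(N-i) P_N(i)
    ([slice_sum_recr]).  It is solved by a q-analogue of the reflection formula
    for ballot numbers,
      P_N(j) = q^(N(N-j)) ([N+j-1 ; N] - q^(N-j+1) [N+j-1 ; N+1])
    ([prefix_sumE]); the two q-Pascal rules verify it for j <= N, with the
    symmetry of the central q-binomial in addition at the last position
    ([qballot_recr], [qballot_last]).  At j = N all avoiders are counted, and
    [2N-1 ; N] - q [2N-1 ; N+1] = [2N ; N] / [N+1] ([qballot_catalan]).

    All of this holds in any field for any nonzero q that is not a root of
    unity, in particular for the indeterminate. *)

(** * Gaussian binomials *)

(** The Pascal recursion vanishes for k > m, where the quotient of q-factorials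
    makes no sense; the closed formulas below do meet such entries. *)
Fixpoint gauss (R : comNzRingType) (q : R) (m k : nat) : R :=
  match m, k with
  | _, 0%N => 1
  | 0%N, _.+1 => 0
  | m'.+1, k'.+1 => gauss q m' k' + q ^+ k'.+1 * gauss q m' k'.+1
  end.

Section Gauss.
Variables (R : comNzRingType) (q : R).

Lemma gauss0 m : gauss q m 0 = 1. Proof. by case: m. Qed.

Lemma gaussS m k :
  gauss q m.+1 k.+1 = gauss q m k + q ^+ k.+1 * gauss q m k.+1.
Proof. by []. Qed.

Lemma gauss_small m k : (m < k)%N -> gauss q m k = 0.
Proof.
elim: m k => [|m IHm] [|k] //= lt_mk.
by rewrite !IHm ?mulr0 ?addr0 // ltnW.
Qed.

(** The quotient of consecutive q-binomials, cross-multiplied; the extra power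
    of [q] turns the exponent m - k into k and m, so that the identity holds for
    all m and k without truncated subtraction. *)
Lemma gauss_ratio m k :
  q ^+ k * (1 - q ^+ k.+1) * gauss q m k.+1 = (q ^+ k - q ^+ m) * gauss q m k.
Proof.
elim: m k => [|m IHm] [|k].
- by rewrite /= subrr mul0r mulr0.
- by rewrite /= !mulr0.
- have := IHm 0%N; rewrite gaussS !gauss0 !exprS !expr0 !mulr1 !mul1r => e.
  have -> : (1 - q) * (1 + q * gauss q m 1)
          = 1 - q + q * ((1 - q) * gauss q m 1) by ring.
  by rewrite e; ring.
- have e1 := IHm k; have e2 := IHm k.+1.
  rewrite !gaussS.
  have -> : q ^+ k.+1 * (1 - q ^+ k.+2) *
            (gauss q m k.+1 + q ^+ k.+2 * gauss q m k.+2)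
    = q ^+ k.+1 * (1 - q ^+ k.+2) * gauss q m k.+1
      + q ^+ k.+2 * (q ^+ k.+1 * (1 - q ^+ k.+2) * gauss q m k.+2) by ring.
  rewrite e2.
  have -> : (q ^+ k.+1 - q ^+ m.+1) * (gauss q m k + q ^+ k.+1 * gauss q m k.+1)
    = q * ((q ^+ k - q ^+ m) * gauss q m k)
      + (q ^+ k.+1 - q ^+ m.+1) * q ^+ k.+1 * gauss q m k.+1.
    by rewrite !exprS; ring.
  by rewrite -e1 !exprS; ring.
Qed.

(** The other q-Pascal rule, with q^(m-k) as weight, again multiplied through by
    q^k. It is the difference of the first rule and [gauss_ratio]. *)
Lemma gaussS_dual m k :
  q ^+ k * gauss q m.+1 k.+1
  = q ^+ k * gauss q m k.+1 + q ^+ m * gauss q m k.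
Proof.
rewrite gaussS; have := gauss_ratio m k; rewrite !exprS => e.
apply/eqP; rewrite -subr_eq0; apply/eqP.
transitivity ((q ^+ k - q ^+ m) * gauss q m k
     - q ^+ k * (1 - q * q ^+ k) * gauss q m k.+1); first by ring.
by rewrite e subrr.
Qed.

(** For m = 2n+1 and k = n, both factors of [gauss_ratio] are
    q^n (1 - q^(n+1)). *)
Lemma gauss_central_sym n :
  GRing.lreg q -> GRing.lreg (1 - q ^+ n.+1) ->
  gauss q (n + n.+1) n.+1 = gauss q (n + n.+1) n.
Proof.
move=> rq r1; have := gauss_ratio (n + n.+1) n.
rewrite exprD -[q ^+ n - _]/(_ - _ * _) -{2}[q ^+ n]mulr1 -mulrBr -!mulrA.
by move/(@lregX _ _ n rq)/r1.
Qed.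

(** By induction with the Pascal rule, this reduces to
    (1 - q^(k+1)) + q^(k+1) (1 - q^(m-k)) = 1 - q^(m+1). *)
Lemma gauss_prod (m k : nat) : (k <= m)%N ->
  gauss q m k * (\prod_(i < k) (1 - q ^+ i.+1) * \prod_(i < m - k) (1 - q ^+ i.+1))
  = \prod_(i < m) (1 - q ^+ i.+1).
Proof.
elim: m k => [|m IHm] [|k] //= le_km; first by rewrite !big_ord0 !mulr1.
  by rewrite big_ord0 !mul1r.
rewrite subSS mulrDl.
have e1 := IHm k le_km.
rewrite [in X in X + _]big_ord_recr /=.
transitivity ((1 - q ^+ k.+1) * \prod_(i < m) (1 - q ^+ i.+1)
   + q ^+ k.+1 * (1 - q ^+ (m - k)) * \prod_(i < m) (1 - q ^+ i.+1)).
  congr (_ + _); first by rewrite -e1; ring.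
  move: le_km; rewrite ltnS leq_eqVlt => /orP[/eqP-> | lt_km].
    by rewrite gauss_small // subnn subrr; ring.
  rewrite -(IHm k.+1 lt_km) (_ : m - k = (m - k.+1).+1)%N; last by lia.
  by rewrite (big_ord_recr (m - k.+1)) /=; ring.
have em : q ^+ m.+1 = q ^+ k.+1 * q ^+ (m - k) by rewrite -exprD addSn subnKC.
by rewrite big_ord_recr /= em; ring.
Qed.
End Gauss.

(** * The major index under insertion of a largest letter *)

(** Words with letters at positions 0, ..., [n], as functions on [nat]: shifted
    positions then need no casts between ordinals of different sizes. *)
Definition maj_word (n : nat) (v : nat -> nat) : nat :=
  (\sum_(0 <= k < n) (v k.+1 < v k) * k.+1)%N.

Lemma maj_wordE n (s : 'S_n.+1) : maj s = maj_word n (fun k => s (inord k)).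
Proof.
rewrite /maj /maj_word big_ord_recr /= [X in (_ + X)%N]big1 ?addn0; last first.
  by move=> j /andP[/eqP ej _]; have := ltn_ord j; rewrite ej ltnn.
rewrite big_mkord; apply: eq_bigr => i _.
have lt_i : (i.+1 < n.+1)%N by rewrite ltnS.
have ei : inord i = widen_ord (leqnSn n) i :> 'I_n.+1.
  by apply: val_inj; rewrite /= inordK // ltnW.
have ej : inord i.+1 = Ordinal lt_i :> 'I_n.+1.
  by apply: val_inj; rewrite /= inordK.
rewrite ei ej (eq_bigl (fun j => (j == Ordinal lt_i) &&
   (s (Ordinal lt_i) < s (widen_ord (leqnSn n) i))%N)); last first.
  by move=> j; rewrite -val_eqE /=; case: eqP => //= e;
     rewrite (_ : j = Ordinal lt_i) //; apply: val_inj.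
case: ltnP => _; last by rewrite big_pred0 // => j; rewrite andbF.
by rewrite mul1n (eq_bigl (pred1 (Ordinal lt_i))) ?big_pred1_eq // => j; rewrite andbT.
Qed.

Definition insert_word (i x : nat) (v : nat -> nat) (k : nat) : nat :=
  if (k < i)%N then v k else if k == i then x else v k.-1.

Lemma eq_maj_word n v w :
  (forall k, (k <= n)%N -> v k = w k) -> maj_word n v = maj_word n w.
Proof.
move=> e; rewrite /maj_word !big_mkord; apply: eq_bigr => k _.
by rewrite !e // ltnW.
Qed.

Lemma maj_word_cat n i v : (i <= n)%N ->
  maj_word n v = (maj_word i v + \sum_(i <= k < n) (v k.+1 < v k) * k.+1)%N.
Proof. by move=> le_in; rewrite /maj_word (@big_cat_nat _ _ _ i). Qed.

Lemma maj_word_decr n i v : (i <= n)%N ->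
  (forall k, (i <= k < n)%N -> (v k.+1 < v k)%N) ->
  maj_word n v = (maj_word i v + \sum_(i <= k < n) k.+1)%N.
Proof.
move=> le_in dec; rewrite (maj_word_cat _ le_in); congr (_ + _)%N.
by apply: eq_big_nat => k /dec ->; rewrite mul1n.
Qed.

(** Inserting a letter larger than all others where the rest is decreasing: the
    n - i later descents move by one and a descent of weight i + 1 appears, in
    total n + 1; a descent between the letters at i - 1 and i, of weight i,
    becomes an ascent. *)
Lemma maj_insert_decr n i x v : (i <= n)%N ->
  (forall k, (k <= n)%N -> (v k < x)%N) ->
  (forall k, (i <= k < n)%N -> (v k.+1 < v k)%N) ->
  (maj_word n.+1 (insert_word i x v) + ((0 < i) && (v i < v i.-1)) * i
   = maj_word n v + n.+1)%N.
Proof.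
move=> le_in ltx dec.
rewrite (maj_word_decr le_in dec) (@maj_word_decr n.+1 i); last 2 first.
- exact: leqW.
- move=> k /andP[le_ik lt_kn]; rewrite /insert_word.
  have [-> -> ->] : [/\ (k.+1 < i) = false, (k < i) = false & (k.+1 == i) = false]%N.
    by split; lia.
  case: eqP => [_|/eqP nki] /=; first by rewrite ltx.
  by case: k le_ik lt_kn nki => [|k] *; [lia | apply: dec; lia].
have -> : (\sum_(i <= k < n.+1) k.+1 = \sum_(i <= k < n) k.+1 + n.+1)%N.
  by rewrite big_nat_recr.
(* The tails of the two sums agree up to [n.+1], so only the descent that may
   sit just before the insertion point remains to be compared. *)
suff -> : (maj_word i v
   = maj_word i (insert_word i x v) + ((0 < i) && (v i < v i.-1)) * i)%N by lia.
case: i {dec} le_in => [|i] le_in; first by rewrite /maj_word !big_geq.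
have nlt : (x < v i)%N = false by have := ltx i (ltnW le_in); lia.
rewrite /maj_word !big_nat_recr //= /insert_word ltnn eqxx ltnSn nlt mul0n addn0.
congr (_ + _)%N; apply: eq_big_nat => k /andP[_ lt_ki].
by rewrite ltnS lt_ki (leqW lt_ki).
Qed.

Lemma maj_insert_last n x v :
  (forall k, (k <= n)%N -> (v k < x)%N) ->
  maj_word n.+1 (insert_word n.+1 x v) = maj_word n v.
Proof.
move=> ltx; have nlt : (x < v n)%N = false by have := ltx n (leqnn n); lia.
rewrite /maj_word big_nat_recr //= /insert_word ltnn eqxx ltnSn nlt mul0n addn0.
apply: eq_big_nat => k /andP[_ lt_ki].
by rewrite !ltnS lt_ki (ltnW lt_ki).
Qed.

(** * Inserting the largest value into a permutation *)

Definition maxpos n (s : 'S_n.+1) : 'I_n.+1 := (s^-1)%g ord_max.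
Definition insmax n (i : 'I_n.+2) (s : 'S_n.+1) : 'S_n.+2 := lift_perm i ord_max s.

Lemma maxpos_insmax n i (s : 'S_n.+1) : maxpos (insmax i s) = i.
Proof. by rewrite /maxpos lift_permV lift_perm_id. Qed.

Lemma perm_maxpos n (s : 'S_n.+1) : s (maxpos s) = ord_max.
Proof. exact: permKV. Qed.

Lemma insmax_lift n i (s : 'S_n.+1) k : insmax i s (lift i k) = s k :> nat.
Proof. by rewrite lift_perm_lift lift_max. Qed.

Lemma insmax_at n i (s : 'S_n.+1) : insmax i s i = n.+1 :> nat.
Proof. by rewrite lift_perm_id. Qed.

Lemma insmax_inj n : injective (fun u : 'I_n.+2 * 'S_n.+1 => insmax u.1 u.2).
Proof.
move=> [i s] [j t] /= e.
have eij : i = j by rewrite -(maxpos_insmax i s) e maxpos_insmax.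
rewrite -eij in e *; congr (_, _); apply/permP => k; apply: val_inj.
by rewrite /= -(insmax_lift i) e insmax_lift.
Qed.

(** Every permutation arises once; by counting, injectivity suffices. *)
Lemma insmax_bij n : bijective (fun u : 'I_n.+2 * 'S_n.+1 => insmax u.1 u.2).
Proof.
apply: inj_card_bij; first exact: insmax_inj.
by rewrite card_prod card_ord !card_Sn.
Qed.

Lemma lt_lift n (i : 'I_n.+1) (j k : 'I_n) : (lift i j < lift i k)%N = (j < k)%N.
Proof. by rewrite /= /bump; lia. Qed.

Lemma avoids312P n (s : 'S_n) :
  reflect (forall i j k : 'I_n, (i < j < k)%N -> ~~ (s j < s k < s i)%N) (avoids312 s).
Proof.
apply: (iffP idP) => [+ i j k /andP[lt_ij lt_jk]|av].
  apply: contra => /andP[lt1 lt2].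
  by apply/existsP; exists i; apply/existsP; exists j; apply/existsP; exists k;
     rewrite lt_ij lt_jk lt1.
apply/negP => /existsP[i /existsP[j /existsP[k /and4P[lt_ij lt_jk lt1 lt2]]]].
by have := av i j k; rewrite lt_ij lt_jk lt1 lt2; move/(_ isT).
Qed.

Lemma perm_lt_max n (s : 'S_n.+1) k : k != maxpos s -> (s k < n)%N.
Proof.
move=> ne; rewrite ltn_neqAle -ltnS ltn_ord andbT.
apply: contra ne => /eqP e; apply/eqP/(@perm_inj _ s); rewrite perm_maxpos.
exact: val_inj.
Qed.

(** The largest value would play the role of 3 in front of any later ascent. *)
Lemma avoids312_decr n (s : 'S_n.+1) (j k : 'I_n.+1) :
  avoids312 s -> (maxpos s <= j < k)%N -> (s k < s j)%N.
Proof.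
move=> /avoids312P av /andP[le_mj lt_jk].
have sk : (s k < n)%N.
  by apply: perm_lt_max; apply: contraTneq (leq_ltn_trans le_mj lt_jk) => ->; rewrite ltnn.
case: (eqVneq (maxpos s) j) => [<-|ne_mj]; first by rewrite perm_maxpos.
have lt_mj : (maxpos s < j)%N by rewrite ltn_neqAle ne_mj.
have := av (maxpos s) j k; rewrite lt_mj lt_jk perm_maxpos /= sk andbT -leqNgt => /(_ isT).
rewrite leq_eqVlt => /orP[/eqP/val_inj/perm_inj e|//].
by rewrite e ltnn in lt_jk.
Qed.

(** A new 312 must use the new value as its 3, followed by an ascent; the entries
    of s from i on have none exactly when i is at or after the old largest
    value. *)
Lemma avoids312_insmax n (i : 'I_n.+2) (s : 'S_n.+1) :
  avoids312 (insmax i s) = avoids312 s && (maxpos s <= i)%N.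
Proof.
apply/idP/andP => [/avoids312P av|[av le_mi]].
  split.
    apply/avoids312P => a b c /andP[lt_ab lt_bc].
    have := av (lift i a) (lift i b) (lift i c).
    by rewrite !insmax_lift !lt_lift lt_ab lt_bc; apply.
  rewrite leqNgt; apply/negP => lt_im.
  (* The old maximum and the entry before it form the forbidden ascent. *)
  have lt_m : ((maxpos s).-1 < n.+1)%N by have := ltn_ord (maxpos s); lia.
  pose b := Ordinal lt_m.
  have ne : b != maxpos s by rewrite -val_eqE /=; lia.
  have := av i (lift i b) (lift i (maxpos s)).
  rewrite insmax_at !insmax_lift perm_maxpos perm_lt_max //= ltnSn /bump.
  by lia.
apply/avoids312P => a b c /andP[lt_ab lt_bc].
case: (unliftP i b) lt_ab lt_bc => [b' ->|->] lt_ab lt_bc; last first.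
  by rewrite insmax_at; have := ltn_ord (insmax i s c); lia.
case: (unliftP i c) lt_bc => [c' ->|->] lt_bc; last first.
  by rewrite insmax_at; have := ltn_ord (insmax i s a); lia.
rewrite !insmax_lift; rewrite lt_lift in lt_bc.
case: (unliftP i a) lt_ab => [a' ->|->] lt_ab.
  by rewrite lt_lift in lt_ab; rewrite insmax_lift; apply: (avoids312P _ av); rewrite lt_ab.
have := @avoids312_decr _ s b' c' av.
by move: lt_ab; rewrite /= /bump; lia.
Qed.

Lemma insmax_word n (i : 'I_n.+2) (s : 'S_n.+1) k : (k <= n.+1)%N ->
  insmax i s (inord k) = insert_word i n.+1 (fun k => s (inord k)) k :> nat.
Proof.
move=> le_k; have := @inordK n.+1 k le_k.
rewrite /insert_word; case: (unliftP i (inord k)) => [k' -> | ->].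
  rewrite insmax_lift /= /bump => ek.
  have [le_ik|lt_ki] := leqP i k'; move: ek.
    rewrite le_ik add1n => <-; rewrite ltnNge leqW //= gtn_eqF //=.
    by congr (nat_of_ord (s _)); apply: val_inj; rewrite /= inordK.
  rewrite leqNgt lt_ki add0n => <-; rewrite lt_ki.
  by congr (nat_of_ord (s _)); apply: val_inj; rewrite /= inordK.
by rewrite insmax_at => ->; rewrite ltnn eqxx.
Qed.

(** No larger entry precedes the old largest value, so no descent is lost. *)
Lemma maj_insmax_eq n (i : 'I_n.+2) (s : 'S_n.+1) :
  avoids312 s -> i = maxpos s :> nat -> maj (insmax i s) = (maj s + n.+1)%N.
Proof.
move=> av ei; rewrite !maj_wordE (eq_maj_word (@insmax_word _ i s)).
rewrite -(@maj_insert_decr n i n.+1) //; last first.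
- move=> k /andP[le_ik lt_kn]; apply: avoids312_decr => //.
  by rewrite -ei !inordK ?le_ik //= ltnW.
- by rewrite ei -ltnS.
rewrite ei inord_val perm_maxpos [X in (_ + X)%N](_ : _ = 0)%N ?addn0 //.
by rewrite [(_ < nat_of_ord (s _))%N]ltnNge /= leq_ord andbF.
Qed.

(** At n + 1, at the end, nothing changes. Before that, the insertion point lies
    strictly inside the final decreasing run, so that a descent of weight i is
    lost against the gain of n + 1. *)
Lemma maj_insmax_gt n (i : 'I_n.+2) (s : 'S_n.+1) :
  avoids312 s -> (maxpos s < i)%N -> maj (insmax i s) = (maj s + (n.+1 - i))%N.
Proof.
move=> av lt_mi; rewrite !maj_wordE (eq_maj_word (@insmax_word _ i s)).
have := ltn_ord i; rewrite ltnS leq_eqVlt => /orP[/eqP ei|lt_i].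
  by rewrite ei maj_insert_last // subnn addn0.
suff : (maj_word n.+1 (insert_word i n.+1 (fun k => s (inord k))) + i
  = maj_word n (fun k => s (inord k)) + n.+1)%N by lia.
rewrite -(@maj_insert_decr n i n.+1) //; last first.
  move=> k /andP[le_ik lt_kn]; apply: avoids312_decr => //.
  by rewrite !inordK ?(leq_trans (ltnW lt_mi)) //= ltnW.
rewrite (leq_trans _ lt_mi) //= (_ : (_ < _)%N = true) ?mul1n //.
by apply: avoids312_decr => //; rewrite !inordK //; lia.
Qed.

(** In the inverse, inserting at [i] lifts the old entries monotonically and
    appends [i]; only the last pair of entries, the positions of the two largest
    values, can contribute a new descent. *)
Lemma majV_insmax n (i : 'I_n.+2) (s : 'S_n.+1) :
  maj (insmax i s)^-1%g = (maj s^-1%g + (i <= maxpos s) * n.+1)%N.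
Proof.
rewrite !maj_wordE lift_permV /maj_word big_nat_recr //=.
have tl k : (k < n.+1)%N ->
    lift_perm ord_max i s^-1 (inord k) = lift i (s^-1 (inord k))%g.
  move=> lt_k; rewrite (_ : inord k = lift ord_max (inord k)) ?lift_perm_lift //.
  by apply: ord_inj; rewrite [RHS]lift_max !inordK // ltnW.
congr (_ + _ * _)%N.
  by apply: eq_big_nat => k /andP[_ lt_k]; rewrite !tl ?lt_lift // ltnW.
have eM m : inord m = ord_max :> 'I_m.+1 by apply: val_inj; rewrite /= inordK.
rewrite (tl n) // !eM lift_perm_id -/(maxpos s) /= /bump; lia.
Qed.

(** * The weighted count by position of the largest value *)

Section Weights.
Variables (F : fieldType) (q : F).

Definition weight n (s : 'S_n) : F := q ^+ (maj s + maj s^-1%g).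

Lemma weight_insmax n (i : 'I_n.+2) (s : 'S_n.+1) :
  avoids312 s -> (maxpos s <= i)%N ->
  weight (insmax i s)
  = (if i == maxpos s :> nat then q ^+ (n.+1).*2 else q ^+ (n.+1 - i)) * weight s.
Proof.
move=> av le_mi; rewrite /weight majV_insmax.
case: eqVneq => [ei|ne].
  by rewrite maj_insmax_eq // ei leqnn -exprD; congr (_ ^+ _); lia.
have lt_mi : (maxpos s < i)%N by rewrite ltn_neqAle eq_sym ne.
by rewrite maj_insmax_gt // [(i <= _)%N]leqNgt lt_mi -exprD; congr (_ ^+ _); lia.
Qed.

Definition prefix_sum n (j : nat) : F :=
  \sum_(s : 'S_n.+1 | avoids312 s && (maxpos s < j)%N) weight s.
Definition slice_sum n (j : nat) : F :=
  \sum_(s : 'S_n.+1 | avoids312 s && (maxpos s == j :> nat)) weight s.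

Lemma prefix_sum0 n : prefix_sum n 0 = 0.
Proof. by rewrite /prefix_sum big_pred0 // => s; rewrite andbF. Qed.

Lemma prefix_sumS n j : prefix_sum n j.+1 = prefix_sum n j + slice_sum n j.
Proof.
rewrite /prefix_sum (bigID (fun s => (maxpos s < j)%N)) /=; congr (_ + _);
  apply: eq_bigl => s; rewrite -andbA; congr (_ && _); lia.
Qed.

Lemma slice_sum_recr n (i : 'I_n.+2) :
  slice_sum n.+1 i = q ^+ (n.+1).*2 * slice_sum n i + q ^+ (n.+1 - i) * prefix_sum n i.
Proof.
rewrite /slice_sum (reindex _ (onW_bij _ (@insmax_bij n))) /=.
transitivity (\sum_(j | j == i) \sum_(s | avoids312 (insmax j s)) weight (insmax j s)).
  rewrite pair_big_dep /=; apply: eq_bigl => -[j s] /=.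
  by rewrite maxpos_insmax andbC val_eqE.
rewrite big_pred1_eq (bigID (fun s : 'S_n.+1 => maxpos s == i :> nat)) /=.
rewrite !mulr_sumr; congr (_ + _).
  apply: eq_big => [s|s /andP[+ /eqP e]].
    by rewrite avoids312_insmax; case: eqP => [->|_]; rewrite ?leqnn ?andbF ?andbT.
  by rewrite avoids312_insmax => /andP[av le]; rewrite weight_insmax // e eqxx.
apply: eq_big => [s|s /andP[+ ne]].
  by rewrite avoids312_insmax -andbA; congr (_ && _); lia.
by rewrite avoids312_insmax => /andP[av le]; rewrite weight_insmax // eq_sym (negbTE ne).
Qed.

Lemma slice_sum_last n : slice_sum n n.+1 = 0.
Proof.
by rewrite /slice_sum big_pred0 // => s; rewrite (ltn_eqF (ltn_ord _)) andbF.
Qed.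

(** At q = 1 this is the ballot number C(n+j, n+1) - C(n+j, n+2): by reflection,
    the number of lattice paths to (j-1, n+1) that stay weakly on one side of
    the diagonal. *)
Definition qballot n j : F :=
  q ^+ (n.+1 * (n.+1 - j)) *
  (gauss q (n + j) n.+1 - q ^+ (n.+2 - j) * gauss q (n + j) n.+2).

Hypothesis q0 : q != 0.
Hypothesis q1 : forall k, q ^+ k.+1 != 1.

(** Shifting the exponents by [a] and [b] clears the powers of [q] that the
    division-free form [gaussS_dual] carries on both sides. *)
Lemma gaussS_dual_shift m k a b : (k + b = m + a)%N ->
  q ^+ a * gauss q m.+1 k.+1 = q ^+ a * gauss q m k.+1 + q ^+ b * gauss q m k.
Proof.
move=> e; apply: (mulfI (expf_neq0 k q0)).
rewrite mulrCA gaussS_dual !mulrDr [q ^+ k * (q ^+ b * _)]mulrA -exprD e exprD.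
by congr (_ + _); ring.
Qed.

Lemma qballot0 n : qballot n 0 = 0.
Proof. by rewrite /qballot addn0 !gauss_small // !mulr0 subr0 mulr0. Qed.

(** The rule [gaussS] lowers both terms at once, because the power of [q] in
    front of [qballot n i] is the one that the rule asks for. *)
Lemma qballot_diff n i : (i <= n)%N ->
  qballot n i.+1 - qballot n i
  = q ^+ (n.+1 * (n - i)) * (gauss q (n + i) n - q ^+ (n.+1 - i) * gauss q (n + i) n.+1).
Proof.
move=> le_in; rewrite /qballot addnS !subSS !(gaussS _ _ n) (gaussS _ _ n.+1).
rewrite subSn // [(n.+2 - i)%N]subSn ?leqW // subSn //.
by rewrite mulnS exprD !exprS; ring.
Qed.

Lemma qballot_recr n i : (i <= n)%N ->
  qballot n.+1 i.+1 - qballot n.+1 i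
  = q ^+ (n.+1).*2 * (qballot n i.+1 - qballot n i) + q ^+ (n.+1 - i) * qballot n i.
Proof.
move=> le_in; rewrite !qballot_diff //; last exact: leqW.
rewrite /qballot.
have [d en] : exists d, n = (d + i)%N by exists (n - i)%N; rewrite subnK.
have -> : (n.+1 - i = d.+1)%N by lia.
have -> : (n.+2 - i = d.+2)%N by lia.
have -> : (n - i = d)%N by lia.
rewrite addSn.
have := @gaussS_dual_shift (n + i) n 0 i; rewrite addn0 expr0 !mul1r => -> //.
have := @gaussS_dual_shift (n + i) n.+1 1 i; rewrite addn1 expr1 => e2.
have -> : q ^+ d.+2 * gauss q (n + i).+1 n.+2
  = q ^+ d.+1 * (q * gauss q (n + i).+1 n.+2) by rewrite exprS; ring.
rewrite e2 // -addnn exprD.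
have -> : (n.+2 * d.+1 = n.+1 * d.+1 + d.+1)%N by lia.
have -> : (n.+1 * d.+1 = n.+1 * d + n.+1)%N by lia.
have eq : q ^+ n.+1 = q ^+ d.+1 * q ^+ i by rewrite -exprD en.
rewrite !exprD eq !exprS; ring.
Qed.

Lemma onem_neq0 k : 1 - q ^+ k.+1 != 0.
Proof. by rewrite subr_eq0 eq_sym. Qed.

(** The last position has no old slice to inherit from, and the closed form
    agrees because the central q-binomial is symmetric. *)
Lemma qballot_last n :
  qballot n.+1 n.+2 - qballot n.+1 n.+1 = qballot n n.+1.
Proof.
rewrite qballot_diff // /qballot !subSnn !subnn !muln0 !expr0 !mul1r addSn gaussS.
have := @gaussS_dual_shift (n + n.+1) n.+1 1 n.+1; rewrite expr1 => ->; last by lia.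
rewrite gauss_central_sym; [by ring | exact: mulfI | exact/mulfI/onem_neq0].
Qed.

Lemma avoids312_S1 (s : 'S_1) : avoids312 s.
Proof. by apply/avoids312P => i j k; rewrite !ord1. Qed.

Lemma prefix_sum_S1 : prefix_sum 0 1 = 1.
Proof.
rewrite /prefix_sum (big_pred1 (1%g : 'S_1)) => [|s].
  by rewrite /weight !maj_wordE /maj_word !big_geq.
rewrite avoids312_S1 ltn_ord; apply/esym/eqP/permP => i.
by rewrite !ord1.
Qed.

Lemma prefix_sumE n j : (j <= n.+1)%N -> prefix_sum n j = qballot n j.
Proof.
elim: n j => [|n IHn] j.
  case: j => [|[|//]] _; first by rewrite prefix_sum0 qballot0.
  by rewrite prefix_sum_S1 /qballot /= !(mulr0, addr0, mulr1, subr0, expr0).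
elim: j => [|j IHj] le_j; first by rewrite prefix_sum0 qballot0.
rewrite prefix_sumS (slice_sum_recr (Ordinal le_j)) IHj ?(ltnW le_j) //=.
rewrite -[RHS](subrK (qballot n.+1 j)) [LHS]addrC; congr (_ + _).
move: le_j; rewrite ltnS leq_eqVlt => /orP[/eqP->|lt_j].
  by rewrite slice_sum_last mulr0 add0r subnn mul1r IHn // qballot_last.
rewrite qballot_recr // -!IHn // ?prefix_sumS 1?ltnW //.
by congr (_ * _ + _); ring.
Qed.

Lemma qpoch_neq0 m : qpoch q m != 0.
Proof. by apply/prodf_neq0 => i _; exact: onem_neq0. Qed.

Lemma qbinomE m k : (k <= m)%N -> qbinom q m k = gauss q m k.
Proof.
move=> le_km; apply: (canLR (mulfK _)).
  by rewrite mulf_neq0 ?qpoch_neq0.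
exact/esym/gauss_prod.
Qed.

Lemma qintE m : (1 - q) * qint q m = 1 - q ^+ m.
Proof. by rewrite -opprB mulNr -subrX1 opprB. Qed.

(** With a = [2N-1 ; N] = [2N-1 ; N-1] and N = n + 1, the Pascal rule gives
    [2N ; N] = (1 + q^N) a and [gauss_ratio] gives
    (1 - q^(N+1)) [2N-1 ; N+1] = (1 - q^(N-1)) a, and
    (1 - q^(N+1)) - q (1 - q^(N-1)) = (1 - q) (1 + q^N). *)
Lemma qballot_catalan n :
  qballot n n.+1 = 1 / qint q n.+2 * qbinom q (2 * n.+1) n.+1.
Proof.
have n1 : 1 - q != 0 by have := onem_neq0 0; rewrite expr1.
have nI : qint q n.+2 != 0.
  by have := onem_neq0 n.+1; rewrite -qintE mulf_eq0 (negbTE n1).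
rewrite qbinomE; last by lia.
rewrite /qballot subnn muln0 expr0 mul1r subSnn expr1.
rewrite (_ : (2 * n.+1 = (n + n.+1).+1)%N); last by lia.
rewrite gaussS -gauss_central_sym; [| exact: mulfI | exact/mulfI/onem_neq0].
apply: (mulfI nI); rewrite mulrA mulrA mulr1 divff // mul1r.
apply: (mulfI n1); rewrite mulrA qintE.
have e := gauss_ratio q (n + n.+1) n.+1; rewrite exprD in e.
have {}e : (1 - q ^+ n.+2) * gauss q (n + n.+1) n.+2
       = (1 - q ^+ n) * gauss q (n + n.+1) n.+1.
  by apply: (mulfI (expf_neq0 n.+1 q0)); rewrite mulrA e; ring.
rewrite mulrBr mulrCA e !exprS; ring.
Qed.

Lemma sum_weight n :
  \sum_(s : 'S_n.+1 | avoids312 s) weight s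
  = 1 / qint q n.+2 * qbinom q (2 * n.+1) n.+1.
Proof.
rewrite -qballot_catalan -prefix_sumE //.
by apply: eq_bigl => s; rewrite ltn_ord andbT.
Qed.
End Weights.

(** * Specialization to the indeterminate *)

Theorem corollary4p16 (n : nat) (hn : (1 <= n)%N) :
  tofrac (calA n).['X] = 1 / qint qvar n.+1 * qbinom qvar (2 * n)%N n.
Proof.
case: n hn => // n _.
rewrite -sum_weight.
- rewrite /calA horner_sum rmorph_sum; apply: eq_bigr => s _ /=.
  by rewrite !hornerE -exprD rmorphXn.
- by rewrite tofrac_eq0 polyX_eq0.
- move=> k; rewrite -rmorphXn /= -tofrac1 tofrac_eq.
  by apply/negP => /eqP/(congr1 (size : {poly int} -> nat)); rewrite size_polyXn size_poly1.
Qed.
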